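(* Let $\rho\in(\varepsilon/2,\varepsilon)$. Let the data-generating distribution $\mathbb{P}_0$ of $(\tilde\xi_1,\tilde\xi_2)$ be the two-point distribution with $\mathbb{P}_0[(\tilde\xi_1,\tilde\xi_2)=(1,-1)]=\rho$ and $\mathbb{P}_0[(\tilde\xi_1,\tilde\xi_2)=(-1,1)]=1-\rho$. Consider the distributionally robust chance constrained program $$(\star)\qquad\min_{x\in\mathbb{R}}\; x\quad\text{s.t.}\quad \mathbb{P}[x>\tilde\xi_1,\;x<\tilde\xi_2]\ge 1-\varepsilon\;\;\forall\mathbb{P}\in\mathcal{F}(\theta),\quad 0\le x\le 1.$$ Then, as $N\to\infty$, with probability going to $1$, the Bonferroni approximation of $(\star)$, which replaces the joint chance constraint with $$\mathbb{P}[x>\tilde\xi_1]\ge 1-\varepsilon_1\;\forall\mathbb{P}\in\mathcal{F}(\theta),\qquad \mathbb{P}[x<\tilde\xi_2]\ge 1-\varepsilon_2\;\forall\mathbb{P}\in\mathcal{F}(\theta),$$ becomes infeasible for any choice of risk thresholds $(\varepsilon_1,\varepsilon_2)$.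
   Context: Risk threshold $\varepsilon\in(0,1)$. The samples $\hat{\boldsymbol{\xi}}_1,\dots,\hat{\boldsymbol{\xi}}_N\in\mathbb{R}^2$ are drawn independently from $\mathbb{P}_0$; ''with probability going to $1$'' refers to the sampling. $\hat{\mathbb{P}}=\frac1N\sum_{i=1}^N\delta_{\hat{\boldsymbol{\xi}}_i}$ is the empirical distribution and $\mathcal{F}(\theta)=\{\mathbb{P}\in\mathcal{P}(\mathbb{R}^2) : d_{\rm W}(\mathbb{P},\hat{\mathbb{P}})\le\theta\}$, where $\mathcal{P}(\mathbb{R}^2)$ is the set of probability distributions on $\mathbb{R}^2$ and $d_{\rm W}(\mathbb{P}_1,\mathbb{P}_2)$ is the type-1 Wasserstein distance (infimum of $\mathbb{E}[\|\tilde{\boldsymbol{\xi}}-\tilde{\boldsymbol{\xi}}'\|]$ over all joint distributions with marginals $\mathbb{P}_1,\mathbb{P}_2$) for a $p$-norm $\|\cdot\|$ with $p\in\mathbb{Q}$, $p>1$. The radius $\theta=\theta_N>0$ satisfies $\theta_N\to0$ as $N\to\infty$, and the probability that $\mathbb{P}_0\in\mathcal{F}(\theta_N)$ tends to one as $N\to\infty$. Bonferroni risk thresholds are numbers $\varepsilon_1,\varepsilon_2\ge0$ with $\varepsilon_1+\varepsilon_2=\varepsilon$. The approximation is infeasible if no $x\in[0,1]$ satisfies both of its chance constraints. *)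

(* Defs.v *)
From HB Require Import structures.
From mathcomp Require Import all_boot all_order all_algebra.
From mathcomp Require Import finmap.
From mathcomp Require Import all_classical all_reals all_analysis.

Set Implicit Arguments.
Unset Strict Implicit.
Unset Printing Implicit Defensive.

Import Order.TTheory GRing.Theory Num.Theory.
Import numFieldNormedType.Exports.

Local Open Scope classical_set_scope.
Local Open Scope ring_scope.

(* The plane with its Borel sigma-algebra (the product of the Borel
   sigma-algebras of the two factors). *)
Notation plane R := (measurableTypeR R * measurableTypeR R)%type.

Definition pnorm (R : realType) (p : rat) (v : plane R) : R :=
  (`|v.1| `^ ratr p + `|v.2| `^ ratr p) `^ (ratr p)^-1.

Definition coupling (R : realType) (mu nu : {measure set (plane R) -> \bar R})
    (pi : probability (plane R * plane R)%type R) : Prop :=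
  forall A : set (plane R), measurable A ->
    pi (fst @^-1` A) = mu A /\ pi (snd @^-1` A) = nu A.

(* The infimum is taken in the extended reals; the value is +oo when every
   coupling has infinite cost. *)
Definition wasserstein1 (R : realType) (p : rat)
    (mu nu : {measure set (plane R) -> \bar R}) : \bar R :=
  ereal_inf [set (\int[pi]_z (pnorm p (z.1 - z.2))%:E)%E
            | pi in [set pi | coupling mu nu pi]].

(* The samples are x 0, ..., x (N - 1).  This is a probability measure as soon
   as 0 < N; for N = 0 it is the zero measure, which has no couplings. *)
Definition empirical (R : realType) (x : nat -> plane R) (N : nat) :
    {measure set (plane R) -> \bar R} :=
  mscale (N%:R^-1)%:nng (msum (fun i => \d_(x i)) N).

Definition wasserstein_ball (R : realType) (p : rat)
    (nu : {measure set (plane R) -> \bar R}) (theta : R) :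
    set (probability (plane R) R) :=
  [set P | (wasserstein1 p P nu <= theta%:E)%E].

Definition dr_chance_constraint d (T : measurableType d) (R : realType)
    (F : set (probability T R)) (E : set T) (eps : R) : Prop :=
  forall P : probability T R, F P -> ((1 - eps)%:E <= P E)%E.

Definition safe1 (R : realType) (x : R) : set (plane R) := [set z | x > z.1].
Definition safe2 (R : realType) (x : R) : set (plane R) := [set z | x < z.2].

(* Feasible set of
     min x  s.t.  P[x > xi_1, x < xi_2] >= 1 - eps for all P in F,
                  0 <= x <= 1;
   it is displayed for comparison with its Bonferroni approximation below. *)
Definition joint_feasible (R : realType) (F : set (probability (plane R) R))
    (eps : R) : set R :=
  [set x | dr_chance_constraint F (safe1 x `&` safe2 x) eps /\ 0 <= x <= 1].

Definition bonferroni_feasible (R : realType)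
    (F : set (probability (plane R) R)) (eps1 eps2 : R) : set R :=
  [set x | [/\ dr_chance_constraint F (safe1 x) eps1,
               dr_chance_constraint F (safe2 x) eps2 & 0 <= x <= 1]].

Definition bonferroni_thresholds (R : realType) (eps eps1 eps2 : R) : Prop :=
  [/\ 0 <= eps1, 0 <= eps2 & eps1 + eps2 = eps].

Definition mutually_independent d d' (Omega : measurableType d)
    (T : measurableType d') (R : realType) (Pr : probability Omega R)
    (X : nat -> {RV Pr >-> T}) : Prop :=
  forall (J : {fset nat}) (A : nat -> set T), (forall i, measurable (A i)) ->
    (Pr (\bigcap_(i in [set` J]) (X i @^-1` A i)) =
     \prod_(i <- J) Pr (X i @^-1` A i))%E.

Definition iid_samples d d' (Omega : measurableType d)
    (T : measurableType d') (R : realType) (Pr : probability Omega R)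
    (X : nat -> {RV Pr >-> T}) (P0 : probability T R) : Prop :=
  mutually_independent X /\
  forall i (A : set T), measurable A -> Pr (X i @^-1` A) = P0 A.

(* "The event E N holds with probability going to 1 as N -> oo".  Events such
   as membership in a Wasserstein ball around the empirical distribution are not
   known a priori to be measurable, so this is phrased with inner probability:
   for measurable E N it is equivalent to Pr (E N) --> 1. *)
Definition probability_to_one d (Omega : measurableType d) (R : realType)
    (Pr : probability Omega R) (E : nat -> set Omega) : Prop :=
  exists A : nat -> set Omega,
    [/\ forall N, measurable (A N),
        forall N, A N `<=` E N &
        Pr (A N) @[N --> \oo] --> 1%E].

(* Main.v *)
Require Import Defs.
From HB Require Import structures.
From mathcomp Require Import all_boot all_order all_algebra.
From mathcomp Require Import finmap.
From mathcomp Require Import all_classical all_reals all_analysis.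
From mathcomp Require Import lra.

(** The Bonferroni approximation fails because the atom [(1, -1)] violates both
    [x > xi_1] and [x < xi_2], for every [x] in [[0, 1]].  Its mass [rho]
    therefore has to be paid twice: a law that gives this atom mass [rho] and
    belongs to the ambiguity set forces [eps1 >= rho] and [eps2 >= rho], so that
    [eps1 + eps2 >= 2 * rho > eps].  (The joint constraint pays for the atom only
    once, and [rho < eps].)

    It remains to find such a law in the ambiguity set.  The data-generating
    distribution is one, and it lies in the Wasserstein ball around the empirical
    distribution with probability going to one; infeasibility holds on every such
    event ([bonferroni_infeasible]). *)

Set Implicit Arguments.
Unset Strict Implicit.
Unset Printing Implicit Defensive.

Import Order.TTheory GRing.Theory Num.Theory.
Import numFieldNormedType.Exports.

Local Open Scope classical_set_scope.
Local Open Scope ring_scope.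

Lemma measurable_safe1 (R : realType) (x : R) : measurable (safe1 x).
Proof.
have -> : safe1 x = fst @^-1` `]-oo, x[%classic.
  by apply/seteqP; split => z /=; rewrite in_itv.
by rewrite -[X in measurable X]setTI; exact: measurable_fst.
Qed.

Lemma measurable_safe2 (R : realType) (x : R) : measurable (safe2 x).
Proof.
have -> : safe2 x = snd @^-1` `]x, +oo[%classic.
  by apply/seteqP; split => z /=; rewrite in_itv /= andbT.
by rewrite -[X in measurable X]setTI; exact: measurable_snd.
Qed.

Lemma measurable_point (R : realType) (z : plane R) : measurable [set z].
Proof.
case: z => a b.
have -> : [set (a, b)] = [set a] `*` [set b] :> set (plane R).
  by apply/seteqP; split => [z -> //|[u v] [/= -> ->]].
by apply: measurableX; exact: measurable_set1.
Qed.

(** An atom outside the safe set consumes its whole mass from the risk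
    threshold, as soon as its law is in the ambiguity set. *)
Lemma dr_chance_constraint_atom d (T : measurableType d) (R : realType)
    (F : set (probability T R)) (P : probability T R) (E : set T) (eps m : R)
    (z : T) :
  F P -> measurable E -> measurable [set z] -> ~ E z -> P [set z] = m%:E ->
  dr_chance_constraint F E eps -> m <= eps.
Proof.
move=> FP mE mz Ez Pz /(_ P FP) PE.
have EC : E `<=` ~` [set z] by move=> y Ey yz; apply: Ez; rewrite -yz.
have : (P E <= P (~` [set z]))%E.
  by apply: le_measure => //; rewrite inE //; exact: measurableC.
rewrite probability_setC // Pz -EFinB.
by move=> /(le_trans PE); rewrite lee_fin lerD2l lerN2.
Qed.

Lemma bonferroni_infeasible (R : realType) (F : set (probability (plane R) R))
    (P : probability (plane R) R) (rho eps eps1 eps2 : R) :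
  F P -> P [set (1, -1)] = rho%:E -> eps / 2 < rho ->
  bonferroni_thresholds eps eps1 eps2 -> bonferroni_feasible F eps1 eps2 = set0.
Proof.
move=> FP Prho eps_rho [_ _ eps12].
apply/seteqP; split => // x [cc1 cc2 /andP[x0 x1]].
have unsafe1 : ~ safe1 x (1, -1) by rewrite /safe1 /= ltNge x1.
have unsafe2 : ~ safe2 x (1, -1) by rewrite /safe2 /=; lra.
have rho1 := dr_chance_constraint_atom FP (measurable_safe1 x)
  (measurable_point _) unsafe1 Prho cc1.
have rho2 := dr_chance_constraint_atom FP (measurable_safe2 x)
  (measurable_point _) unsafe2 Prho cc2.
clear -eps_rho eps12 rho1 rho2; lra.
Qed.

Lemma probability_to_one_sub d (Omega : measurableType d) (R : realType)
    (Pr : probability Omega R) (E E' : nat -> set Omega) :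
  (forall N, E N `<=` E' N) ->
  probability_to_one Pr E -> probability_to_one Pr E'.
Proof.
move=> EE' [A [mA AE PrA]]; exists A; split => // N.
exact: subset_trans (AE N) (EE' N).
Qed.

Theorem proposition17 (R : realType) (p : rat) (hp : 1 < p)
  (eps : R) (heps : 0 < eps < 1)
  (rho : R) (hrho : eps / 2 < rho < eps)
  (P0 : probability (plane R) R)
  (hP0_1 : P0 [set (1, -1)] = rho%:E)
  (hP0_2 : P0 [set (-1, 1)] = (1 - rho)%:E)
  (d : measure_display) (Omega : measurableType d) (Pr : probability Omega R)
  (xi : nat -> {RV Pr >-> plane R}) (hxi : iid_samples xi P0)
  (theta : nat -> R) (htheta_gt0 : forall N, 0 < theta N)
  (htheta_cvg : theta N @[N --> \oo] --> 0)
  (hcover : probability_to_one Pr (fun N => [set omega |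
     wasserstein_ball p (empirical (fun i => xi i omega) N) (theta N) P0])) :
  probability_to_one Pr (fun N => [set omega |
    forall eps1 eps2 : R, bonferroni_thresholds eps eps1 eps2 ->
      bonferroni_feasible
        (wasserstein_ball p (empirical (fun i => xi i omega) N) (theta N))
        eps1 eps2 = set0]).
Proof.
have /andP[eps_rho _] := hrho.
apply: probability_to_one_sub hcover => N omega P0_in eps1 eps2.
exact: bonferroni_infeasible P0_in hP0_1 eps_rho.
Qed.
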